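(* Let $A$ and $B$ be lattices with zero such that $A\otimes B$ is a capped tensor product. Then the following holds: (i) For every lattice congruence $\alpha$ of $A$ and every lattice congruence $\beta$ of $B$, $(A/\alpha)\otimes(B/\beta)$ is a capped tensor product. (ii) If $A'$ is a sublattice of $A$ and $B'$ is a sublattice of $B$ such that $A'$ and $B'$ are lattices with zero (it is not assumed that $0_{A'}=0_A$ or that $0_{B'}=0_B$), then $A'\otimes B'$ is a capped tensor product.
   Context: Tensor product. For lattices $A$, $B$ with least elements $0$, put $\bot_{A,B}=(A\times\{0\})\cup(\{0\}\times B)$. A bi-ideal of $A\times B$ is a subset $I\subseteq A\times B$ which is a down-set (for the componentwise order), contains $\bot_{A,B}$, and is closed under lateral joins: $(a,b_0),(a,b_1)\in I$ implies $(a,b_0\vee b_1)\in I$, and $(a_0,b),(a_1,b)\in I$ implies $(a_0\vee a_1,b)\in I$. Ordered by inclusion, the bi-ideals form an algebraic lattice $A\,\bar\otimes\, B$. For $a\in A$, $b\in B$ the pure tensor is the bi-ideal $a\otimes b=\bot_{A,B}\cup\{(x,y)\in A\times B : x\le a,\ y\le b\}$. The tensor product $A\otimes B$ is the join-semilattice with zero of compact elements of $A\,\bar\otimes\,B$, i.e. the set of all finite joins (in $A\,\bar\otimes\,B$) of pure tensors, ordered by inclusion. $A\otimes B$ is a capped tensor product if every element of $A\otimes B$ is a finite union (as sets) of pure tensors. *)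

(* Defs.v *)
From HB Require Import structures.
From mathcomp Require Import all_boot all_order.
From mathcomp Require Import boolp classical_sets.

Set Implicit Arguments.
Unset Strict Implicit.
Unset Printing Implicit Defensive.

Import Order.LTheory.

Local Open Scope quotient_scope.
Local Open Scope order_scope.

Record congruence (d : Order.disp_t) (A : latticeType d) := Congruence {
  congr_rel :> equiv_rel A;
  congr_meet : forall x x' y y' : A,
    congr_rel x x' -> congr_rel y y' -> congr_rel (x `&` y) (x' `&` y');
  congr_join : forall x x' y y' : A,
    congr_rel x x' -> congr_rel y y' -> congr_rel (x `|` y) (x' `|` y')
}.

Definition quot_lattice (d : Order.disp_t) (A : latticeType d)
  (alpha : congruence A) := {eq_quot alpha}.

HB.instance Definition _ d (A : latticeType d) (alpha : congruence A) :=
  Choice.copy (quot_lattice alpha) {eq_quot alpha}.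
HB.instance Definition _ d (A : latticeType d) (alpha : congruence A) :=
  EqQuotient.copy (quot_lattice alpha) {eq_quot alpha}.

Section QuotLattice.
Local Open Scope quotient_scope.
Context (d : Order.disp_t) (A : latticeType d) (alpha : congruence A).
Local Notation Q := (quot_lattice alpha).

Definition quot_meet (x y : Q) : Q := \pi_Q (repr x `&` repr y).
Definition quot_join (x y : Q) : Q := \pi_Q (repr x `|` repr y).

Lemma quot_piP (x y : A) : reflect (\pi_Q x = \pi_Q y) (alpha x y).
Proof. by rewrite -(eqmodE alpha); apply: eqP. Qed.

Lemma repr_piP (x : A) : alpha (repr (\pi_Q x)) x.
Proof. by apply/quot_piP; rewrite reprK. Qed.

Lemma quot_meetE (x y : A) : quot_meet (\pi x) (\pi y) = \pi_Q (x `&` y).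
Proof. by apply/quot_piP; apply: congr_meet; apply: repr_piP. Qed.

Lemma quot_joinE (x y : A) : quot_join (\pi x) (\pi y) = \pi_Q (x `|` y).
Proof. by apply/quot_piP; apply: congr_join; apply: repr_piP. Qed.

Fact quot_meetC : commutative quot_meet.
Proof.
by elim/quotW=> x; elim/quotW=> y; rewrite !quot_meetE meetC.
Qed.

Fact quot_joinC : commutative quot_join.
Proof.
by elim/quotW=> x; elim/quotW=> y; rewrite !quot_joinE joinC.
Qed.

Fact quot_meetA : associative quot_meet.
Proof.
by elim/quotW=> x; elim/quotW=> y; elim/quotW=> z; rewrite !quot_meetE meetA.
Qed.

Fact quot_joinA : associative quot_join.
Proof.
by elim/quotW=> x; elim/quotW=> y; elim/quotW=> z; rewrite !quot_joinE joinA.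
Qed.

Fact quot_joinKI (y x : Q) : quot_meet x (quot_join x y) = x.
Proof.
by elim/quotW: x => x; elim/quotW: y => y; rewrite quot_joinE quot_meetE joinKI.
Qed.

Fact quot_meetKU (y x : Q) : quot_join x (quot_meet x y) = x.
Proof.
by elim/quotW: x => x; elim/quotW: y => y; rewrite quot_meetE quot_joinE meetKU.
Qed.

Definition quot_le (x y : Q) : bool := quot_meet x y == x.

Fact quot_le_refl : reflexive quot_le.
Proof.
by elim/quotW=> x; apply/eqP; rewrite quot_meetE meetxx.
Qed.

Fact quot_le_anti : antisymmetric quot_le.
Proof. by move=> x y /andP[/eqP xy /eqP yx]; rewrite -yx quot_meetC. Qed.

Fact quot_le_trans : transitive quot_le.
Proof.
by move=> y x z /eqP xy /eqP yz; apply/eqP; rewrite -xy -quot_meetA yz.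
Qed.

HB.instance Definition _ :=
  @Order.Le_isPOrder.Build d Q quot_le quot_le_refl quot_le_anti quot_le_trans.

HB.instance Definition _ :=
  @Order.POrder_isLattice.Build d Q quot_meet quot_join
    quot_meetC quot_joinC quot_meetA quot_joinA quot_joinKI quot_meetKU
    (fun _ _ => erefl).

End QuotLattice.

Section QuotBLattice.
Local Open Scope quotient_scope.
Context (d : Order.disp_t) (A : bLatticeType d) (alpha : congruence A).
Local Notation Q := (quot_lattice alpha).

Definition quot_bot : Q := \pi_Q \bot.

Fact quot_le0x (x : Q) : quot_bot <= x.
Proof.
by elim/quotW: x => x; apply/eqP; rewrite quot_meetE meet0x.
Qed.

HB.instance Definition _ := @Order.hasBottom.Build d Q quot_bot quot_le0x.

End QuotBLattice.

Section Tensor.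
Local Open Scope classical_set_scope.
Context (dA dB : Order.disp_t) (A : bLatticeType dA) (B : bLatticeType dB).

Definition tensor_bot : set (A * B) :=
  [set: A] `*` [set \bot] `|` [set \bot] `*` [set: B].

Record bi_ideal (I : set (A * B)) : Prop := BiIdeal {
  bi_ideal_down : forall (a a' : A) (b b' : B),
    a' <= a -> b' <= b -> I (a, b) -> I (a', b');
  bi_ideal_bot : tensor_bot `<=` I;
  bi_ideal_joinr : forall (a : A) (b0 b1 : B),
    I (a, b0) -> I (a, b1) -> I (a, (b0 `|` b1)%O);
  bi_ideal_joinl : forall (a0 a1 : A) (b : B),
    I (a0, b) -> I (a1, b) -> I ((a0 `|` a1)%O, b)
}.

Definition pure_tensor (a : A) (b : B) : set (A * B) :=
  tensor_bot `|` [set p | p.1 <= a /\ p.2 <= b].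

(* Bi-ideals are closed under arbitrary intersection, so the join of a family
   of bi-ideals is the smallest bi-ideal containing their union. *)
Definition bi_ideal_join (F : set (set (A * B))) : set (A * B) :=
  smallest bi_ideal (\bigcup_(I in F) I).

(* The empty sequence yields tensor_bot = pure_tensor \bot \bot. *)
Definition tensor_product : set (set (A * B)) :=
  [set H | exists s : seq (A * B),
     H = bi_ideal_join [set pure_tensor p.1 p.2 | p in [set` s]]].

Definition capped : Prop :=
  forall H : set (A * B), tensor_product H ->
  exists s : seq (A * B), H = \bigcup_(p in [set` s]) pure_tensor p.1 p.2.

End Tensor.

Arguments tensor_bot {dA dB} A B.
Arguments tensor_product {dA dB} A B.
Arguments capped {dA dB} A B.

(* Main.v *)
(** The bi-ideal generated by finitely many pairs (a_i, b_i) consists, apart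
    from the trivial pairs, of the pairs below some (p(a), p^d(b)), where p is a
    lattice polynomial and p^d its dual.  Hence A ⊗ B is capped if and only if,
    for all generators, finitely many of the pairs (p(a), p^d(b)) dominate all
    the nontrivial ones.  Lattice homomorphisms commute with polynomials, so
    this criterion is inherited by homomorphic images and by sublattices; a
    polynomial value in a sublattice that is the zero of the big lattice is
    also the zero of the sublattice. *)
Require Import Defs.
From mathcomp Require Import all_boot all_order.
From mathcomp Require Import classical_sets.

Set Implicit Arguments.
Unset Strict Implicit.
Unset Printing Implicit Defensive.

Import Order.LTheory.

Local Open Scope order_scope.

(* The pairs (p(a), p^d(b)) of the values of a lattice polynomial p and of its
   dual p^d, with (a, b) enumerated by [s]. *)
Inductive dual_values (dA dB : Order.disp_t) (A : latticeType dA)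
    (B : latticeType dB) (s : seq (A * B)) : A -> B -> Prop :=
| dual_values_var a b : (a, b) \in s -> dual_values s a b
| dual_values_meet a a' b b' : dual_values s a b -> dual_values s a' b' ->
    dual_values s (a `&` a') (b `|` b')
| dual_values_join a a' b b' : dual_values s a b -> dual_values s a' b' ->
    dual_values s (a `|` a') (b `&` b').

Section Morphism.
Context (dA dB dA' dB' : Order.disp_t).
Context (A : latticeType dA) (B : latticeType dB).
Context (A' : latticeType dA') (B' : latticeType dB').
Variables (f : A -> A') (g : B -> B').
Hypotheses (fI : {morph f : x y / x `&` y}) (fU : {morph f : x y / x `|` y}).
Hypotheses (gI : {morph g : x y / x `&` y}) (gU : {morph g : x y / x `|` y}).

Let fg (p : A * B) : A' * B' := (f p.1, g p.2).

Lemma dual_values_map s a b :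
  dual_values s a b -> dual_values (map fg s) (f a) (g b).
Proof.
elim=> [u v uv|u u' v v' _ IH _ IH'|u u' v v' _ IH _ IH'].
- by apply: dual_values_var; apply/mapP; exists (u, v).
- by rewrite fI gU; apply: dual_values_meet.
- by rewrite fU gI; apply: dual_values_join.
Qed.

(** The polynomial that yields [(a', b')] is evaluated at the pairs of [s] instead. Both coordinates
    are lifted at once, since they must come from the same polynomial. *)
Lemma dual_values_map_inv s a' b' : dual_values (map fg s) a' b' ->
  exists2 p, dual_values s p.1 p.2 & fg p = (a', b').
Proof.
elim=> [u v /mapP[p ps ->]|u u' v v' _ [p sp [<- <-]] _ [q sq [<- <-]]
  |u u' v v' _ [p sp [<- <-]] _ [q sq [<- <-]]].
- by exists p => //; apply: dual_values_var; rewrite -surjective_pairing.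
- exists (p.1 `&` q.1, p.2 `|` q.2); first exact: dual_values_meet.
  by rewrite /fg /= fI gU.
- exists (p.1 `|` q.1, p.2 `&` q.2); first exact: dual_values_join.
  by rewrite /fg /= fU gI.
Qed.

End Morphism.

Section Criterion.
Context (dA dB : Order.disp_t) (A : bLatticeType dA) (B : bLatticeType dB).
Implicit Types (s t : seq (A * B)) (x u : A) (y v : B).

Definition dominated t x y : Prop :=
  [\/ x = \bot, y = \bot | exists2 p, p \in t & x <= p.1 /\ y <= p.2].

Lemma tensor_botP x y : tensor_bot A B (x, y) <-> x = \bot \/ y = \bot.
Proof. by split=> [[[_ /= ->]|[/= -> _]]|[->|->]]; [right|left|right|left]. Qed.

(** The pair [(\bot, \bot)] contributes exactly the trivial pairs, which an empty union would
    miss. *)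
Lemma bigcup_pure_tensorP t x y :
  (\bigcup_(p in [set` ((\bot, \bot) : A * B) :: t]) pure_tensor p.1 p.2)%classic
    (x, y) <-> dominated t x y.
Proof.
split=> [[p /= pt [/tensor_botP[->|->]|[/= xp yp]]]|].
- exact: Or31.
- exact: Or32.
- move: pt xp yp; rewrite inE => /predU1P[-> /=|pt xp yp].
    by rewrite lex0 => /eqP-> _; exact: Or31.
  by apply: Or33; exists p.
case=> [x0|y0|[p pt xyp]].
- by exists (\bot, \bot); [rewrite /= mem_head|left; apply/tensor_botP; left].
- by exists (\bot, \bot); [rewrite /= mem_head|left; apply/tensor_botP; right].
- by exists p; [rewrite /= inE pt orbT|right].
Qed.

Definition generated_bi_ideal s : set (A * B) :=
  bi_ideal_join [set pure_tensor p.1 p.2 | p in [set` s]]%classic.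

(** A bi-ideal containing two values also contains them lowered to the meet of their first (or
    second) coordinates; a lateral join then gives the next value, so by induction it contains all
    of them. Conversely, the right-hand side is itself a bi-ideal: pairs below the values of p and q
    have their lateral join below the value of the meet or of the join of p and q. *)
Lemma generated_bi_idealP s x y : generated_bi_ideal s (x, y) <->
  [\/ x = \bot, y = \bot |
      exists2 p, dual_values s p.1 p.2 & x <= p.1 /\ y <= p.2].
Proof.
split; last first.
  move=> + I [bI sI].
  have botI a b : a = \bot \/ b = \bot -> I (a, b).
    by move=> ab; apply: (bi_ideal_bot bI); apply/tensor_botP.
  case=> [x0|y0|[[u v]]]; [by apply: botI; left|by apply: botI; right|].
  move=> /= uv [xu yv]; apply: (bi_ideal_down bI xu yv).
  elim: uv => {x y u v xu yv} [a b ab|a a' b b' _ Iab _ Iab'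
    |a a' b b' _ Iab _ Iab'].
  - by apply: sI; exists (pure_tensor a b); [exists (a, b)|right => /=].
  - apply: (bi_ideal_joinr bI).
      exact: (bi_ideal_down bI (leIl _ _) (lexx _) Iab).
    exact: (bi_ideal_down bI (leIr _ _) (lexx _) Iab').
  - apply: (bi_ideal_joinl bI).
      exact: (bi_ideal_down bI (lexx _) (leIl _ _) Iab).
    exact: (bi_ideal_down bI (lexx _) (leIr _ _) Iab').
pose J : set (A * B) := fun q => [\/ q.1 = \bot, q.2 = \bot |
  exists2 p, dual_values s p.1 p.2 & q.1 <= p.1 /\ q.2 <= p.2].
suff bJ : bi_ideal J.
  apply: (_ : (generated_bi_ideal s `<=` J)%classic).
  apply: smallest_sub => // -[a b] [_ [[u v] /= uv <-]].
  case=> [/tensor_botP[a0|b0]|[/= au bv]]; [exact: Or31|exact: Or32|].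
  by apply: Or33; exists (u, v) => //; apply: dual_values_var.
split.
- move=> a a' b b' a'a b'b [/= a0|/= b0|[p sp [/= ap bp]]].
  + by apply: Or31; apply/eqP; rewrite /= -lex0 -a0.
  + by apply: Or32; apply/eqP; rewrite /= -lex0 -b0.
  + by apply: Or33; exists p => //=; split; apply: le_trans; eassumption.
- by move=> [a b] /tensor_botP[a0|b0]; [exact: Or31|exact: Or32].
- move=> a b b' [/= a0|/= ->|[p sp [/= ap bp]]]; [by move=> _; exact: Or31|
    by rewrite join0x|].
  case=> [/= a0|/= ->|[q sq [/= aq bq]]]; [exact: Or31| |].
    by rewrite joinx0; apply: Or33; exists p.
  apply: Or33; exists (p.1 `&` q.1, p.2 `|` q.2).
    exact: dual_values_meet.
  by rewrite /= lexI ap aq leU2.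
- move=> a a' b [/= ->|/= b0|[p sp [/= ap bp]]]; [by rewrite join0x|
    by move=> _; exact: Or32|].
  case=> [/= ->|/= b0|[q sq [/= aq bq]]]; [|exact: Or32|].
    by rewrite joinx0; apply: Or33; exists p.
  apply: Or33; exists (p.1 `|` q.1, p.2 `&` q.2).
    exact: dual_values_join.
  by rewrite /= lexI bp bq leU2.
Qed.

(** Requiring the entries of [t] to be polynomial values is what lets [t] be carried along
    homomorphisms. *)
Lemma cappedP : capped A B <-> forall s, exists2 t,
  (forall p, p \in t -> dual_values s p.1 p.2) &
  (forall x y, dual_values s x y -> dominated t x y).
Proof.
split=> [cAB s|cAB _ [s ->]]; last first.
  have [t ts st] := cAB s; exists ((\bot, \bot) :: t).
  apply/seteqP; split=> -[x y].
    move=> /generated_bi_idealP xy; apply/bigcup_pure_tensorP.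
    case: xy => [x0|y0|[p /st[p0|p0|[q qt [pq1 pq2]]] [xp yp]]].
    - exact: Or31.
    - exact: Or32.
    - by apply: Or31; apply/eqP; rewrite -lex0 -p0.
    - by apply: Or32; apply/eqP; rewrite -lex0 -p0.
    - by apply: Or33; exists q => //; split; apply: le_trans; eassumption.
  move=> /bigcup_pure_tensorP xy; apply/generated_bi_idealP.
  case: xy => [x0|y0|[p /ts sp xyp]]; [exact: Or31|exact: Or32|].
  by apply: Or33; exists p.
have [c sc] := cAB (generated_bi_ideal s) (ex_intro _ s erefl).
(* The capping pairs in [c] need not be values. Each nontrivial one lies below a value, which
   replaces it; the trivial ones are dropped. *)
have [t ts ct] : exists2 t, (forall p, p \in t -> dual_values s p.1 p.2) &
    (forall p, p \in c -> dominated t p.1 p.2).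
  have : forall p, p \in c -> generated_bi_ideal s p.
    by move=> p pc; rewrite sc; exists p => //; right.
  elim: c {sc} => [|p c IH] cs; first by exists [::].
  have [q qc|t ts ct] := IH; first by apply: cs; rewrite inE qc orbT.
  have : generated_bi_ideal s (p.1, p.2).
    by rewrite -surjective_pairing; apply: cs; rewrite mem_head.
  move=> /generated_bi_idealP[p0|p0|[q sq pq]].
  - by exists t => // r; rewrite inE => /predU1P[->|/ct//]; exact: Or31.
  - by exists t => // r; rewrite inE => /predU1P[->|/ct//]; exact: Or32.
  - exists (q :: t) => r; rewrite inE => /predU1P[->//|]; first exact: ts.
      by apply: Or33; exists q => //; rewrite mem_head.
    move=> /ct[r0|r0|[q' q't rq']]; [exact: Or31|exact: Or32|].
    by apply: Or33; exists q' => //; rewrite inE q't orbT.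
exists t => // x y xy.
have : generated_bi_ideal s (x, y).
  by apply/generated_bi_idealP; apply: Or33; exists (x, y).
rewrite sc => -[p /= pc [/tensor_botP[x0|y0]|[/= xp yp]]].
- exact: Or31.
- exact: Or32.
case: (ct p pc) => [p0|p0|[q qt [pq1 pq2]]].
- by apply: Or31; apply/eqP; rewrite -lex0 -p0.
- by apply: Or32; apply/eqP; rewrite -lex0 -p0.
- by apply: Or33; exists q => //; split; apply: le_trans; eassumption.
Qed.

End Criterion.

Section Transfer.
Context (dA dB dA' dB' : Order.disp_t).
Context (A : bLatticeType dA) (B : bLatticeType dB).
Context (A' : bLatticeType dA') (B' : bLatticeType dB').

(** Generators are lifted along the sections [f'] and [g'], which need not be homomorphisms; a
    dominating sequence found upstairs is mapped down. *)
Lemma capped_surj (f : A -> A') (f' : A' -> A) (g : B -> B') (g' : B' -> B) :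
  {morph f : x y / x `&` y} -> {morph f : x y / x `|` y} -> f \bot = \bot ->
  cancel f' f ->
  {morph g : x y / x `&` y} -> {morph g : x y / x `|` y} -> g \bot = \bot ->
  cancel g' g ->
  capped A B -> capped A' B'.
Proof.
move=> fI fU f0 f'K gI gU g0 g'K /cappedP cAB; apply/cappedP => s.
pose fg (p : A * B) := (f p.1, g p.2).
have f_le x y : x <= y -> f x <= f y by move=> /meet_idPl xy; rewrite -xy fI leIr.
have g_le x y : x <= y -> g x <= g y by move=> /meet_idPl xy; rewrite -xy gI leIr.
have -> : s = map fg [seq (f' p.1, g' p.2) | p <- s].
  by rewrite -map_comp map_id_in// => -[x y] _; rewrite /fg /= f'K g'K.
have [t ts st] := cAB [seq (f' p.1, g' p.2) | p <- s].
exists (map fg t) => [_ /mapP[p /ts sp ->]|x y].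
  exact: dual_values_map.
move=> /(dual_values_map_inv fI fU gI gU)[p /st pt [<- <-]].
case: pt => [->|->|[q qt [pq1 pq2]]]; [exact: Or31|exact: Or32|].
apply: Or33; exists (fg q); first exact: map_f.
by split; [exact: f_le|exact: g_le].
Qed.

(** An injective homomorphism reflects the order, so domination in the big lattices can be pulled
    back. *)
Lemma capped_inj (f : A' -> A) (g : B' -> B) :
  {morph f : x y / x `&` y} -> {morph f : x y / x `|` y} -> injective f ->
  {morph g : x y / x `&` y} -> {morph g : x y / x `|` y} -> injective g ->
  capped A B -> capped A' B'.
Proof.
move=> fI fU f_inj gI gU g_inj /cappedP cAB; apply/cappedP => s.
pose fg (p : A' * B') := (f p.1, g p.2).
have f_le x y : f x <= f y -> x <= y.
  by move=> /meet_idPl; rewrite -fI => /f_inj/meet_idPl.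
have g_le x y : g x <= g y -> x <= y.
  by move=> /meet_idPl; rewrite -gI => /g_inj/meet_idPl.
have [t ts st] := cAB (map fg s).
(* Values of polynomials at images are images, so [t] lies in the range of [fg]. *)
have [t' t's t't] : exists2 t' : seq (A' * B'),
    (forall p, p \in t' -> dual_values s p.1 p.2) & t = map fg t'.
  elim: t ts {st} => [|[u v] t IH] ts; first by exists [::].
  have [p pt|t' t's ->] := IH; first by apply: ts; rewrite inE pt orbT.
  have /(dual_values_map_inv fI fU gI gU)[p sp <-] := ts _ (mem_head _ _).
  by exists (p :: t') => // q; rewrite inE => /predU1P[->//|/t's].
exists t' => // x y /(dual_values_map fI fU gI gU)/st[x0|y0|].
(* If [f x] is the zero of [A], then it lies below [f \bot], whatever that is, and hence [x] lies
   below [\bot]. *)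
- by apply: Or31; apply/eqP; rewrite -lex0; apply: f_le; rewrite x0 le0x.
- by apply: Or32; apply/eqP; rewrite -lex0; apply: g_le; rewrite y0 le0x.
rewrite t't => -[_ /mapP[q qt' ->] [/f_le xq /g_le yq]].
by apply: Or33; exists q.
Qed.

End Transfer.

Theorem proposition4p5 (dA dB : Order.disp_t)
    (A : bLatticeType dA) (B : bLatticeType dB) :
  capped A B ->
  (forall (alpha : congruence A) (beta : congruence B),
     capped (quot_lattice alpha) (quot_lattice beta))
  /\
  (forall (dA' dB' : Order.disp_t) (SA : pred A) (SB : pred B)
     (A' : subBLattice SA dA') (B' : subBLattice SB dB'),
     capped A' B').
Proof.
move=> cAB; split=> [alpha beta|dA' dB' SA SB A' B'].
  (* The zero of a quotient is by definition the class of [\bot]. *)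
  apply: (capped_surj (f := \pi_(quot_lattice alpha)%qT) (f' := repr)
    (g := \pi_(quot_lattice beta)%qT) (g' := repr) _ _ _ _ _ _ _ _ cAB) => //.
  - by move=> x y; rewrite -quot_meetE.
  - by move=> x y; rewrite -quot_joinE.
  - exact: reprK.
  - by move=> x y; rewrite -quot_meetE.
  - by move=> x y; rewrite -quot_joinE.
  - exact: reprK.
apply: (capped_inj (f := val) (g := val) _ _ _ _ _ _ cAB).
- exact: Order.valI_subproof.
- exact: Order.valU_subproof.
- exact: val_inj.
- exact: Order.valI_subproof.
- exact: Order.valU_subproof.
- exact: val_inj.
Qed.
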